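(* Let $(K_f,A_g)$ be a Riemann–Roch pair on a lattice $\Lambda$. Then there exist: (1) (Chern classes) a group homomorphism $c\colon K_f\to A_g^\times$ with $c([T^u])=1+[\partial_u]$ for all $u\in\Lambda$; (2) (a $\lambda$-ring structure on $K_f$) a group homomorphism $\lambda\colon K_f\to K_f[[t]]^\times$ with $\lambda([T^u])=1+[T^u]t$ for all $u\in\Lambda$; (3) (a determinant map) a group homomorphism $\det\colon K_f\to K_f^1$, where $K_f^1$ is the image of $\Lambda$ in $K_f^\times$ (under $u\mapsto[T^u]$), with $\det([T^u])=[T^u]$ for all $u\in\Lambda$; (4) (a Todd operator) a group homomorphism $\mathrm{Td}\colon K_f\to(\mathbb{Q}A_g)^\times$ satisfying $$\mathrm{Td}([T^u])=\frac{[\partial_u]}{1-\exp(-[\partial_u])}\qquad\text{for all }u\in\Lambda.$$ Here the source $K_f$ is regarded as an additive group and the targets as multiplicative groups.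
   Context: A lattice $\Lambda$ is a free abelian group of finite rank; $P(\Lambda)$ is the ring of polynomial functions $\Lambda\to\mathbb{Q}$ with rational coefficients. $\mathrm{Sh}(\Lambda)=\mathbb{Z}[\Lambda]$ is the group ring with basis $T^u$, acting on functions by $(T^uh)(x)=h(x+u)$. $\mathrm{Diff}(\Lambda)$ is the ring of differential operators with constant integer coefficients acting on $P(\Lambda)$; $\partial_u$ is the directional derivative along $u\in\Lambda$. $\mathbb{Q}R=\mathbb{Q}\otimes_{\mathbb{Z}}R$. For $f,g\in P(\Lambda)$, $K_f=\mathrm{Sh}(\Lambda)/\mathrm{Ann}(f)$, $A_g=\mathrm{Diff}(\Lambda)/\mathrm{Ann}(g)$, where $\mathrm{Ann}$ is the ideal of operators killing the polynomial; $[D]\cdot g:=D\cdot g$ for $[D]\in\mathbb{Q}A_g$. $(K_f,A_g)$ is a Riemann–Roch pair if $f,g\in P(\Lambda)$, $g$ is homogeneous, and there is a unit $\mathrm{td}\in(\mathbb{Q}A_g)^\times$ with $f=\mathrm{td}\cdot g$. The classes $[\partial_u]$ are nilpotent, and $x/(1-\exp(-x))\in\mathbb{Q}[[x]]$ is the power series $1+x/2+\cdots$, so (4) makes sense. *)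

(* Defs.v *)
From HB Require Import structures.
From mathcomp Require Import all_boot all_order all_algebra.
From mathcomp Require Import generic_quotient ring_quotient.
From mathcomp Require Import boolp.
From mathcomp Require Import finmap.
From mathcomp Require monalg.
(* Its canonical instances only: its {mpoly R[n]} clashes with that of mpoly. *)
Import (canonicals) monalg.
From mathcomp Require Import ssrcomplements mpoly.
From mathcomp Require Import ring zify.

Set Implicit Arguments.
Unset Strict Implicit.
Unset Printing Implicit Defensive.

Import Order.TTheory GRing.Theory Num.Theory.
Local Open Scope ring_scope.
Local Open Scope quotient_scope.

(* ------------------------------------------------------------------------ *)
(* The rings K_f and A_g are zero when f and g are, so everything below is   *)
(* done for possibly zero ("pz") rings, which unitRingType excludes.         *)

Definition invertible (R : comPzRingType) (x : R) : Prop := exists y, x * y = 1.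

(* Homomorphisms from the additive group V to the multiplicative group of R. *)
Definition unit_hom (V : zmodType) (R : comPzRingType) (phi : V -> R) : Prop :=
  (forall x, invertible (phi x)) /\ (forall x y, phi (x + y) = phi x * phi y).

(* ------------------------------------------------------------------------ *)
(* {ideal_quot I} of the library requires I to be proper; this does not.     *)

HB.mixin Record isMulAbsorbing (R : comPzRingType) (S : R -> bool) := {
  absorb_mull : forall a u, u \in S -> a * u \in S
}.

#[short(type="pzIdeal")]
HB.structure Definition PzIdeal (R : comPzRingType) :=
  {S of GRing.ZmodClosed R S & isMulAbsorbing R S}.

Definition quot_ring (R : comPzRingType) (I : pzIdeal R) : Type :=
  Quotient.quot I.

Section QuotRing.
Variables (R : comPzRingType) (I : pzIdeal R).

HB.instance Definition _ := GRing.Zmodule.on (quot_ring I).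

Definition qcls (x : R) : quot_ring I := \pi_(Quotient.quot I) x.

Lemma qcls_eq x y : qcls x = qcls y <-> x - y \in I.
Proof.
split=> [/eqP|h]; first by rewrite /qcls -Quotient.idealrBE.
by apply/eqP; rewrite /qcls -Quotient.idealrBE.
Qed.

Lemma qcls_surj (a : quot_ring I) : exists x, a = qcls x.
Proof. by exists (repr (a : Quotient.quot I)); rewrite /qcls reprK. Qed.

Fact qcls_is_zmod_morphism : zmod_morphism qcls.
Proof. by move=> x y; rewrite /qcls raddfB. Qed.

HB.instance Definition _ :=
  GRing.isZmodMorphism.Build R (quot_ring I) qcls qcls_is_zmod_morphism.

Definition quot_mul (a b : quot_ring I) : quot_ring I :=
  qcls (repr (a : Quotient.quot I) * repr (b : Quotient.quot I)).

Lemma qcls_mul x y : quot_mul (qcls x) (qcls y) = qcls (x * y).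
Proof.
have h z : repr (qcls z : Quotient.quot I) - z \in I.
  by apply/qcls_eq; rewrite /qcls reprK.
apply/qcls_eq; set x' := repr _; set y' := repr _.
have -> : x' * y' - x * y = x' * (y' - y) + y * (x' - x).
  by rewrite !mulrBr addrA (mulrC x' y) subrK (mulrC y x).
by rewrite rpredD ?absorb_mull ?h.
Qed.

Fact quot_mulA : associative quot_mul.
Proof.
move=> a b c; have [x ->] := qcls_surj a; have [y ->] := qcls_surj b.
by have [z ->] := qcls_surj c; rewrite !qcls_mul mulrA.
Qed.

Fact quot_mulC : commutative quot_mul.
Proof.
move=> a b; have [x ->] := qcls_surj a; have [y ->] := qcls_surj b.
by rewrite !qcls_mul mulrC.
Qed.

Fact quot_mul1 : left_id (qcls 1) quot_mul.
Proof. by move=> a; have [x ->] := qcls_surj a; rewrite qcls_mul mul1r. Qed.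

Fact quot_mulD : left_distributive quot_mul +%R.
Proof.
move=> a b c; have [x ->] := qcls_surj a; have [y ->] := qcls_surj b.
by have [z ->] := qcls_surj c; rewrite -raddfD !qcls_mul mulrDl raddfD.
Qed.

HB.instance Definition _ := GRing.Zmodule_isComPzRing.Build (quot_ring I)
  quot_mulA quot_mulC quot_mul1 quot_mulD.

Fact qcls_is_monoid_morphism : monoid_morphism qcls.
Proof. by split=> // x y; rewrite -qcls_mul. Qed.

HB.instance Definition _ :=
  GRing.isMonoidMorphism.Build R (quot_ring I) qcls qcls_is_monoid_morphism.

End QuotRing.

(* ------------------------------------------------------------------------ *)
(* Q (x)_Z R, constructed as the localization of R at the positive integers: *)
(* frac a m stands for a / (m + 1).                                          *)

Section Rationalization.
Variable R : comPzRingType.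
Implicit Types x y z : R * nat.

Definition rat_rel x y : bool :=
  `[< exists k : nat, x.1 *+ y.2.+1 *+ k.+1 = y.1 *+ x.2.+1 *+ k.+1 >].

Fact rat_rel_equiv : equiv_class_of rat_rel.
Proof.
split.
- by move=> x; apply/asboolP; exists 0%N.
- by move=> x y; apply/asboolP/asboolP=> -[k h]; exists k.
- move=> y x z /asboolP[k h] /asboolP[l h']; apply/asboolP.
  exists (k.+1 * l.+1 * y.2.+1).-1.
  rewrite prednK ?muln_gt0 //.
  have -> : x.1 *+ z.2.+1 *+ (k.+1 * l.+1 * y.2.+1)
          = (x.1 *+ y.2.+1 *+ k.+1) *+ (z.2.+1 * l.+1).
    by rewrite -!mulrnA; congr (_ *+ _); ring.
  rewrite h.
  have -> : y.1 *+ x.2.+1 *+ k.+1 *+ (z.2.+1 * l.+1)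
          = (y.1 *+ z.2.+1 *+ l.+1) *+ (x.2.+1 * k.+1).
    by rewrite -!mulrnA; congr (_ *+ _); ring.
  by rewrite h' -!mulrnA; congr (_ *+ _); ring.
Qed.

Canonical rat_equiv := EquivRelPack rat_rel_equiv.
Canonical rat_encModRel := defaultEncModRel rat_rel.

Definition rationalization : Type := {eq_quot rat_rel}.
HB.instance Definition _ := Choice.on rationalization.

Definition frac (a : R) (m : nat) : rationalization :=
  \pi_({eq_quot rat_rel}) (a, m).
Definition fnum (q : rationalization) : R :=
  (repr (q : {eq_quot rat_rel})).1.
Definition fden (q : rationalization) : nat :=
  (repr (q : {eq_quot rat_rel})).2.

Lemma frac_eq a m b n : frac a m = frac b n <->
  exists k : nat, a *+ n.+1 *+ k.+1 = b *+ m.+1 *+ k.+1.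
Proof.
split=> [/eqmodP/asboolP //|h]; by apply/eqmodP/asboolP.
Qed.

Lemma fracK q : frac (fnum q) (fden q) = q.
Proof. by rewrite /frac /fnum /fden -surjective_pairing reprK. Qed.

Lemma frac_repr a m : exists k : nat,
  fnum (frac a m) *+ m.+1 *+ k.+1 = a *+ (fden (frac a m)).+1 *+ k.+1.
Proof. by apply/frac_eq; rewrite fracK. Qed.

Definition dmul (m n : nat) : nat := (m.+1 * n.+1).-1.
Lemma dmulS m n : (dmul m n).+1 = (m.+1 * n.+1)%N.
Proof. by rewrite /dmul prednK ?muln_gt0. Qed.

Definition rat_zero := frac 0 0.
Definition rat_one := frac 1 0.
Definition rat_opp q := frac (- fnum q) (fden q).
Definition rat_add p q :=
  frac (fnum p *+ (fden q).+1 + fnum q *+ (fden p).+1) (dmul (fden p) (fden q)).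
Definition rat_mul p q := frac (fnum p * fnum q) (dmul (fden p) (fden q)).
Lemma rat_oppE a m : rat_opp (frac a m) = frac (- a) m.
Proof.
have [k h] := frac_repr a m; apply/frac_eq; exists k.
by rewrite !mulNrn h.
Qed.

Lemma rat_addE a m b n :
  rat_add (frac a m) (frac b n) = frac (a *+ n.+1 + b *+ m.+1) (dmul m n).
Proof.
have [k h] := frac_repr a m; have [l h'] := frac_repr b n.
rewrite /rat_add; move: h h'; set a' := fnum _; set m' := fden _.
set b' := fnum _; set n' := fden _ => h h'.
apply/frac_eq; exists (dmul k l); rewrite !dmulS.
transitivity ((a' *+ m.+1 *+ k.+1) *+ (n'.+1 * n.+1 * l.+1) +
  (b' *+ n.+1 *+ l.+1) *+ (m'.+1 * m.+1 * k.+1)).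
  by rewrite -!mulrnA mulrnDl -!mulrnA; congr (_ *+ _ + _ *+ _); ring.
rewrite h h' -!mulrnA mulrnDl -!mulrnA; congr (_ *+ _ + _ *+ _); ring.
Qed.

Lemma rat_mulE a m b n :
  rat_mul (frac a m) (frac b n) = frac (a * b) (dmul m n).
Proof.
have [k h] := frac_repr a m; have [l h'] := frac_repr b n.
rewrite /rat_mul; move: h h'; set a' := fnum _; set m' := fden _.
set b' := fnum _; set n' := fden _ => h h'.
apply/frac_eq; exists (dmul k l); rewrite !dmulS.
transitivity ((a' *+ m.+1 *+ k.+1) * (b' *+ n.+1 *+ l.+1)).
  by rewrite !(mulrnAl, mulrnAr) -!mulrnA; congr (_ *+ _); ring.
by rewrite h h' !(mulrnAl, mulrnAr) -!mulrnA; congr (_ *+ _); ring.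
Qed.

Fact rat_addA : associative rat_add.
Proof.
move=> p q r; rewrite -(fracK p) -(fracK q) -(fracK r) !rat_addE.
apply/frac_eq; exists 0%N; rewrite !dmulS !mulrnDl -!mulrnA !addrA.
by congr (_ *+ _ + _ *+ _ + _ *+ _); ring.
Qed.

Fact rat_addC : commutative rat_add.
Proof.
move=> p q; rewrite -(fracK p) -(fracK q) !rat_addE addrC.
by apply/frac_eq; exists 0%N; rewrite !dmulS (mulnC (fden q).+1).
Qed.

Fact rat_add0 : left_id rat_zero rat_add.
Proof.
move=> p; rewrite -(fracK p) rat_addE; apply/frac_eq; exists 0%N.
by rewrite mul0rn add0r dmulS mul1n.
Qed.

Fact rat_addN : left_inverse rat_zero rat_opp rat_add.
Proof.
move=> p; rewrite -(fracK p) rat_oppE rat_addE; apply/frac_eq; exists 0%N.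
by rewrite mulNrn addNr !mul0rn.
Qed.

HB.instance Definition _ := GRing.isZmodule.Build rationalization
  rat_addA rat_addC rat_add0 rat_addN.

Fact rat_mulA : associative rat_mul.
Proof.
move=> p q r; rewrite -(fracK p) -(fracK q) -(fracK r) !rat_mulE mulrA.
by apply/frac_eq; exists 0%N; rewrite !dmulS mulnA.
Qed.

Fact rat_mulC : commutative rat_mul.
Proof.
move=> p q; rewrite -(fracK p) -(fracK q) !rat_mulE mulrC.
by apply/frac_eq; exists 0%N; rewrite !dmulS mulnC.
Qed.

Fact rat_mul1 : left_id rat_one rat_mul.
Proof.
move=> p; rewrite -(fracK p) rat_mulE mul1r.
by apply/frac_eq; exists 0%N; rewrite !dmulS mul1n.
Qed.

Fact rat_mulD : left_distributive rat_mul rat_add.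
Proof.
move=> p q r; rewrite -(fracK p) -(fracK q) -(fracK r) !(rat_mulE, rat_addE).
apply/frac_eq; exists 0%N; rewrite !dmulS mulrDl !mulrnDl !mulrnAl -!mulrnA.
by congr (_ *+ _ + _ *+ _); ring.
Qed.

HB.instance Definition _ := GRing.Zmodule_isComPzRing.Build rationalization
  rat_mulA rat_mulC rat_mul1 rat_mulD.

Lemma fracM a m b n : frac a m * frac b n = frac (a * b) (dmul m n).
Proof. exact: rat_mulE. Qed.

Definition iota_rat (a : R) : rationalization := frac a 0.

Fact iota_rat_is_zmod_morphism : zmod_morphism iota_rat.
Proof.
move=> a b; transitivity (rat_add (frac a 0) (rat_opp (frac b 0))) => //.
by rewrite rat_oppE rat_addE.
Qed.

HB.instance Definition _ := GRing.isZmodMorphism.Build R rationalization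
  iota_rat iota_rat_is_zmod_morphism.

Fact iota_rat_is_monoid_morphism : monoid_morphism iota_rat.
Proof. by split=> // a b; rewrite /iota_rat fracM. Qed.

HB.instance Definition _ := GRing.isMonoidMorphism.Build R rationalization
  iota_rat iota_rat_is_monoid_morphism.

Definition rat_const (r : rat) : rationalization :=
  frac (numq r)%:~R `|denq r|.-1.

Lemma rat_constE (i : int) (m : nat) :
  rat_const (i%:~R / m.+1%:R) = frac i%:~R m.
Proof.
apply/frac_eq; exists 0%N; rewrite !mulr1n prednK ?absz_gt0 ?denq_neq0 //.
set r := (i%:~R / m.+1%:R : rat).
have h : numq r *+ m.+1 = i *+ `|denq r|.
  apply: (@intr_inj rat); rewrite !rmorphMn /= numqE -mulrnAl.
  have -> : r *+ m.+1 = i%:~R by rewrite -(mulr_natr r) /r divfK // pnatr_eq0.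
  by rewrite -{1}(absz_denq r) -pmulrn mulr_natr.
by have := congr1 (fun z : int => z%:~R : R) h; rewrite !rmorphMn.
Qed.

Fact rat_natdiv (r : rat) : exists i : int, exists m, r = i%:~R / m.+1%:R.
Proof.
exists (numq r), `|denq r|.-1; rewrite -{1}[r]divq_num_den.
by rewrite prednK ?absz_gt0 ?denq_neq0 // -{1}(absz_denq r).
Qed.

Fact rat_const_is_zmod_morphism : zmod_morphism rat_const.
Proof.
move=> r s; have [a [m ->]] := rat_natdiv r; have [b [n ->]] := rat_natdiv s.
have -> : a%:~R / m.+1%:R - b%:~R / n.+1%:R
       = (a * n.+1%:Z - b * m.+1%:Z)%:~R / (dmul m n).+1%:R :> rat.
  rewrite dmulS natrM rmorphB !rmorphM /= -!pmulrn.
  have M0 : m.+1%:R != 0 :> rat by rewrite pnatr_eq0.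
  have N0 : n.+1%:R != 0 :> rat by rewrite pnatr_eq0.
  move: (m.+1%:R : rat) (n.+1%:R : rat) M0 N0 => M N M0 N0.
  by field; rewrite N0 M0.
rewrite !rat_constE.
transitivity (rat_add (frac a%:~R m) (rat_opp (frac b%:~R n))) => //.
rewrite rat_oppE rat_addE; congr frac.
by rewrite rmorphB !rmorphM /= -!pmulrn !mulr_natr mulNrn.
Qed.

HB.instance Definition _ := GRing.isZmodMorphism.Build rat rationalization
  rat_const rat_const_is_zmod_morphism.

Fact rat_const_is_monoid_morphism : monoid_morphism rat_const.
Proof.
split=> [|r s]; first by rewrite /rat_const.
have [a [m ->]] := rat_natdiv r; have [b [n ->]] := rat_natdiv s.
have -> : (a%:~R / m.+1%:R) * (b%:~R / n.+1%:R)
       = (a * b)%:~R / (dmul m n).+1%:R :> rat.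
  rewrite dmulS natrM rmorphM /=.
  have M0 : m.+1%:R != 0 :> rat by rewrite pnatr_eq0.
  have N0 : n.+1%:R != 0 :> rat by rewrite pnatr_eq0.
  move: (m.+1%:R : rat) (n.+1%:R : rat) M0 N0 => M N M0 N0.
  by field; rewrite N0 M0.
by rewrite !rat_constE fracM rmorphM.
Qed.

HB.instance Definition _ := GRing.isMonoidMorphism.Build rat rationalization
  rat_const rat_const_is_monoid_morphism.

End Rationalization.

(* ------------------------------------------------------------------------ *)
(* Formal power series R[[t]], as coefficient sequences.                     *)

Definition pseries (R : Type) : Type := nat -> R.

Section PowerSeries.
Variable R : comPzRingType.
Implicit Types F G H : pseries R.

HB.instance Definition _ := gen_eqMixin (pseries R).
HB.instance Definition _ := gen_choiceMixin (pseries R).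

Definition ps_zero : pseries R := fun _ => 0.
Definition ps_opp F : pseries R := fun n => - F n.
Definition ps_add F G : pseries R := fun n => F n + G n.
Definition ps_one : pseries R := fun n => (n == 0%N)%:R.
Definition ps_mul F G : pseries R := fun n => \sum_(i < n.+1) F i * G (n - i)%N.

Fact ps_addA : associative ps_add.
Proof. by move=> F G H; apply/funext=> n; apply: addrA. Qed.
Fact ps_addC : commutative ps_add.
Proof. by move=> F G; apply/funext=> n; apply: addrC. Qed.
Fact ps_add0 : left_id ps_zero ps_add.
Proof. by move=> F; apply/funext=> n; apply: add0r. Qed.
Fact ps_addN : left_inverse ps_zero ps_opp ps_add.
Proof. by move=> F; apply/funext=> n; apply: addNr. Qed.

HB.instance Definition _ := GRing.isZmodule.Build (pseries R)
  ps_addA ps_addC ps_add0 ps_addN.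

Fact ps_mulC : commutative ps_mul.
Proof.
move=> F G; apply/funext=> n; rewrite /ps_mul (reindex_inj rev_ord_inj) /=.
by apply: eq_bigr => i _; rewrite !subSS subKn ?leq_ord // mulrC.
Qed.

Fact ps_mulA : associative ps_mul.
Proof.
move=> F G H; apply/funext=> i; rewrite [RHS]/ps_mul.
rewrite (reindex_inj rev_ord_inj) /= /ps_mul.
pose c j k := F j * (G (i - j - k)%N * H k).
transitivity (\sum_(j < i.+1) \sum_(k < i.+1 | (k <= i - j)%N) c j k).
  apply: eq_bigr => /= j _; rewrite mulr_sumr.
  rewrite (reindex_inj rev_ord_inj) /=.
  rewrite (big_ord_narrow_leq (leq_subr j i)); apply: eq_bigr => k _ /=.
  by rewrite !subSS /c subKn // -ltnS.
rewrite (exchange_big_dep predT) //=; apply: eq_bigr => k _.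
rewrite !subSS subKn ?leq_ord // mulr_suml.
transitivity (\sum_(j < i.+1 | (j <= i - k)%N) c j k).
  by apply: eq_bigl => j; have := ltn_ord j; have := ltn_ord k; lia.
rewrite (big_ord_narrow_leq (leq_subr k i)); apply: eq_bigr => j _ /=.
by rewrite /c -!subnDA addnC mulrA.
Qed.

Fact ps_mul1 : left_id ps_one ps_mul.
Proof.
move=> F; apply/funext=> n; rewrite /ps_mul big_ord_recl mul1r subn0.
by rewrite big1 ?addr0 // => i _; rewrite mul0r.
Qed.

Fact ps_mulD : left_distributive ps_mul +%R.
Proof.
move=> F G H; apply/funext=> n; rewrite /ps_mul -[RHS]big_split /=.
by apply: eq_bigr => i _; rewrite mulrDl.
Qed.

HB.instance Definition _ := GRing.Zmodule_isComPzRing.Build (pseries R)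
  ps_mulA ps_mulC ps_mul1 ps_mulD.

Definition psC (a : R) : pseries R := fun n => a *+ (n == 0%N).
Definition psX : pseries R := fun n => (n == 1%N)%:R.

End PowerSeries.

Arguments psX {R}.

(* ------------------------------------------------------------------------ *)

Definition exp_neg : pseries rat := fun k => (-1) ^+ k / k`!%:R.

(* (1 - exp(-x)) / x *)
Definition one_sub_exp_neg_div : pseries rat :=
  fun k => (-1) ^+ k / k.+1`!%:R.

(* The inverse of E := (1 - exp(-x)) / x, which has constant term 1, is the  *)
(* geometric series in 1 - E; only (1 - E)^j with j <= k reach degree k.     *)
Definition todd : pseries rat :=
  fun k => (\sum_(j < k.+1) (1 - one_sub_exp_neg_div) ^+ j) k.

Section ToddSeries.
Local Notation E := one_sub_exp_neg_div.
Local Notation U := (1 - one_sub_exp_neg_div).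

Lemma ps_mul_coef (R : comPzRingType) (F G : pseries R) n :
  (F * G) n = \sum_(i < n.+1) F i * G (n - i)%N.
Proof. by []. Qed.

Lemma ps_sum_coef (R : comPzRingType) m (F : 'I_m -> pseries R) n :
  (\sum_(i < m) F i) n = \sum_(i < m) F i n.
Proof. exact: (big_morph (fun F : pseries R => F n)). Qed.

Fact todd_aux_low j k : (k < j)%N -> (U ^+ j) k = 0.
Proof.
elim: j k => // j IHj k; rewrite ltnS exprS ps_mul_coef => lekj.
rewrite big_ord_recl /= [X in X * _](_ : _ = 0) ?mul0r ?add0r; last first.
  by rewrite -[LHS]/(1 - 1 / 1%:R : rat) divr1 subrr.
apply: big1 => i _; rewrite IHj ?mulr0 //= /bump /= add1n.
by apply: leq_trans lekj; rewrite subnS prednK ?leq_subr // subn_gt0.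
Qed.

Fact todd_trunc N k : (k < N)%N -> todd k = (\sum_(j < N) U ^+ j) k.
Proof.
elim: N => // N IHN; rewrite ltnS leq_eqVlt => /predU1P[<- //|ltkN].
by rewrite IHN // big_ord_recr -[RHS]/(_ k + _ k) todd_aux_low // addr0.
Qed.

Lemma todd_mulE : todd * E = 1.
Proof.
apply/funext => n; rewrite ps_mul_coef.
transitivity (((\sum_(j < n.+1) U ^+ j) * E) n).
  by apply: eq_bigr => i _; rewrite (todd_trunc (ltn_ord i)).
have -> : (\sum_(j < n.+1) U ^+ j) * E = 1 - U ^+ n.+1.
  rewrite -[RHS]opprB subrX1 -mulNr opprB opprB mulrC; congr (_ * _).
  by rewrite addrC subrK.
by rewrite -[LHS]/(_ n - _ n) todd_aux_low // subr0.
Qed.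

Lemma toddP : todd * (1 - exp_neg) = psX.
Proof.
have -> : 1 - exp_neg = E * psX.
  apply/funext => -[|k]; rewrite ps_mul_coef.
    by rewrite big_ord1 mulr0 -[LHS]/(1 - 1 / 1%:R : rat) divr1 subrr.
  rewrite big_ord_recr big_ord_recr /= big1 ?add0r; last first.
    move=> i _; rewrite /psX; case: eqP; rewrite ?mulr0 //.
    by have := ltn_ord i; lia.
  rewrite subSn // !subnn -[psX 1%N]/(1 : rat) -[psX 0%N]/(0 : rat) mulr1 mulr0 addr0.
  by rewrite -[LHS]/(0 - (-1) ^+ k.+1 / k.+1`!%:R) sub0r exprS mulN1r mulNr opprK.
by rewrite mulrA todd_mulE mul1r.
Qed.

Lemma todd0 : todd 0%N = 1.
Proof. by rewrite /todd big_ord1. Qed.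

Lemma todd1 : todd 1%N = 1 / 2%:R.
Proof. by rewrite /todd ps_sum_coef !big_ord_recl big_ord0 /=. Qed.

End ToddSeries.

(* b is the value F(a) at a nilpotent a of a series F with coefficients in Q. *)
Definition ps_value (R : comPzRingType) (F : pseries rat)
    (a b : rationalization R) : Prop :=
  exists N : nat, a ^+ N = 0 /\ b = \sum_(k < N) rat_const R (F k) * a ^+ k.

(* ------------------------------------------------------------------------ *)
(* Lattices: free abelian groups of finite rank, given with a basis, that is *)
(* an isomorphism to Z^n. Polynomials on the lattice and differential        *)
(* operators are written in these coordinates; the notions below do not      *)
(* depend on the basis.                                                      *)

HB.mixin Record Zmodule_isZLattice L of GRing.Zmodule L := {
  lrank : nat;
  lcoord : L -> 'rV[int]_lrank;
  lcoord_is_zmod_morphism : zmod_morphism lcoord;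
  lcoord_bij : bijective lcoord
}.

#[short(type="zlatticeType")]
HB.structure Definition ZLattice :=
  {L of GRing.Zmodule L & Zmodule_isZLattice L}.

Arguments lrank : clear implicits.


(* A Z-basis b_1, ..., b_n provides the data required by the structure. *)
Section LatticeOfBasis.
Variables (L : zmodType) (n : nat) (b : 'I_n -> L).
Let comb (c : 'rV[int]_n) : L := \sum_i b i *~ c ord0 i.
Hypothesis b_basis : bijective comb.

Lemma zlattice_of_basis : exists f : L -> 'rV[int]_n,
  zmod_morphism f /\ bijective f.
Proof.
have combB : zmod_morphism comb.
  move=> x y; rewrite /comb -sumrB; apply: eq_bigr => i _.
  by rewrite !mxE mulrzBr.
have [f combK fK] := b_basis; exists f; split; last by exists comb.
by move=> x y; apply: (can_inj combK); rewrite combB !fK.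
Qed.

End LatticeOfBasis.

(* ------------------------------------------------------------------------ *)
(* The group ring Sh(L) = Z[L], with basis shift u = T^u: finitely supported *)
(* functions L -> int under convolution.                                     *)

Definition group_ring (L : zmodType) : Type := monalg.malg L int.

Section GroupRing.
Variable L : zmodType.
Implicit Types s t : group_ring L.

HB.instance Definition _ :=
  GRing.Zmodule.copy (group_ring L) (monalg.malg L int).

Definition gcoef (u : L) (s : group_ring L) : int := monalg.mcoeff u s.
Definition gsupp (s : group_ring L) : {fset L} := monalg.msupp s.
Definition shift (u : L) : group_ring L := monalg.mkmalgU u 1.

(* The Z-linear map with shift u |-> h u. *)
Definition glift (V : zmodType) (h : L -> V) (s : group_ring L) : V :=
  \sum_(u <- gsupp s) h u *~ gcoef u s.

Section Glift.
Variables (V : zmodType) (h : L -> V).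

Lemma gliftw (d : {fset L}) s : (gsupp s `<=` d)%fset ->
  glift h s = \sum_(u <- d) h u *~ gcoef u s.
Proof.
move=> sd; rewrite /glift (big_fset_incl _ sd) // => u _ us.
by rewrite /gcoef monalg.mcoeff_outdom.
Qed.

Fact glift_is_zmod_morphism : zmod_morphism (glift h).
Proof.
move=> s t; pose d := (gsupp s `|` gsupp t)%fset.
rewrite (@gliftw d (s - t)) ?monalg.msuppB_le //.
rewrite (@gliftw d s) ?fsubsetUl // (@gliftw d t) ?fsubsetUr //.
by rewrite -sumrB; apply: eq_bigr => u _; rewrite /gcoef monalg.mcoeffB mulrzBr.
Qed.

HB.instance Definition _ :=
  GRing.isZmodMorphism.Build (group_ring L) V (glift h) glift_is_zmod_morphism.

Lemma glift_shift u : glift h (shift u) = h u.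
Proof.
by rewrite /glift /gsupp /gcoef monalg.msuppU big_seq_fset1 monalg.mcoeffUU.
Qed.

End Glift.

Lemma group_ringE s : s = glift shift s.
Proof.
rewrite /glift [LHS]monalg.monalgE; apply: eq_bigr => u _.
rewrite /shift -[X in X = _]/(monalg.mkmalgU u (gcoef u s)).
by rewrite -{1}[gcoef u s]intz raddfMz.
Qed.

Lemma group_ring_ext (V : zmodType) (phi psi : {additive group_ring L -> V}) :
  (forall u, phi (shift u) = psi (shift u)) -> forall s, phi s = psi s.
Proof.
move=> h s; rewrite (group_ringE s) /glift !raddf_sum; apply: eq_bigr => u _.
by rewrite !raddfMz h.
Qed.

Lemma eq_glift (V : zmodType) (h h' : L -> V) s :
  (forall u, h u = h' u) -> glift h s = glift h' s.
Proof. by move=> e; apply: eq_bigr => u _; rewrite e. Qed.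

Lemma raddf_glift (V W : zmodType) (phi : {additive V -> W}) (h : L -> V) s :
  phi (glift h s) = glift (fun u => phi (h u)) s.
Proof. by rewrite raddf_sum; apply: eq_bigr => u _; rewrite raddfMz. Qed.

Lemma glift_glift (V : zmodType) (h : L -> V) (k : L -> group_ring L) s :
  glift h (glift k s) = glift (fun u => glift h (k u)) s.
Proof. exact: raddf_glift. Qed.

Definition gmul s t : group_ring L :=
  glift (fun u => glift (fun v => shift (u + v)) t) s.

Fact gmulA : associative gmul.
Proof.
move=> s t r; rewrite /gmul glift_glift; apply: eq_glift => u.
rewrite !glift_glift; apply: eq_glift => v.
rewrite glift_shift glift_glift; apply: eq_glift => w.
by rewrite glift_shift addrA.
Qed.

Fact gmulC : commutative gmul.
Proof.
move=> s t; rewrite /gmul /glift.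
under eq_bigr do rewrite mulrz_suml.
rewrite exchange_big /=; apply: eq_bigr => v _.
rewrite mulrz_suml; apply: eq_bigr => u _.
by rewrite addrC mulrzAC.
Qed.

Fact gmul1 : left_id (shift 0) gmul.
Proof.
move=> s; rewrite /gmul glift_shift [RHS]group_ringE.
by apply: eq_glift => u; rewrite add0r.
Qed.

Fact gmulDl : left_distributive gmul +%R.
Proof. by move=> s t r; rewrite /gmul raddfD. Qed.

HB.instance Definition _ := GRing.Zmodule_isComPzRing.Build (group_ring L)
  gmulA gmulC gmul1 gmulDl.

Lemma shift0 : shift 0 = 1. Proof. by []. Qed.

Lemma shiftD u v : shift (u + v) = shift u * shift v.
Proof. by rewrite -[RHS]/(gmul _ _) /gmul !glift_shift. Qed.

(* (T^u h)(x) = h(x + u), extended linearly. *)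
Definition shift_act s (h : L -> rat) : L -> rat :=
  fun x => glift (fun u => h (x + u)) s.

Lemma shift_act_shift u h x : shift_act (shift u) h x = h (x + u).
Proof. exact: glift_shift. Qed.

Lemma shift_actB s t h x :
  shift_act (s - t) h x = shift_act s h x - shift_act t h x.
Proof. exact: raddfB. Qed.

Lemma shift_actM s t h x :
  shift_act (s * t) h x = shift_act s (shift_act t h) x.
Proof.
rewrite /shift_act -[s * t]/(gmul s t) glift_glift; apply: eq_glift => u.
rewrite glift_glift; apply: eq_glift => v.
by rewrite glift_shift addrA.
Qed.

Lemma shift_act0 s x : shift_act s (fun _ => 0) x = 0.
Proof. by rewrite /shift_act /glift big1 // => u _; rewrite mul0rz. Qed.

End GroupRing.

(* ------------------------------------------------------------------------ *)
(* A polynomial function L -> Q is represented by the unique polynomial in   *)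
(* the coordinates that defines it.                                          *)

Notation polyfun L := {mpoly rat[lrank L]}.

Definition peval (L : zlatticeType) (h : polyfun L) (x : L) : rat :=
  h.@[fun i => (lcoord x ord0 i)%:~R].

(* Diff(L) = Z[d_1, ..., d_n], where d_i is the derivative along the i-th    *)
(* basis vector of L.                                                        *)
Notation diff_ring L := {mpoly int[lrank L]}.

Section DiffAct.
Variable n : nat.
Implicit Types (D : {mpoly int[n]}) (h : {mpoly rat[n]}).

Definition diff_act D h : {mpoly rat[n]} :=
  \sum_(m <- msupp D) h^`M[m] *~ D@_m.

Lemma diff_actw k D h : (msize D <= k)%N ->
  diff_act D h = \sum_(m : 'X_{1..n < k}) h^`M[m] *~ D@_m.
Proof.
move=> le_Dk; pose I : subFinType _ := 'X_{1..n < k}.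
rewrite /diff_act (big_mksub I) ?msupp_uniq //=; first last.
  by move=> m /msize_mdeg_lt /leq_trans; apply.
by rewrite big_rmcond //= => m /memN_msupp_eq0 ->.
Qed.

Lemma diff_actB D D' h : diff_act (D - D') h = diff_act D h - diff_act D' h.
Proof.
pose k := maxn (msize (D - D')) (maxn (msize D) (msize D')).
rewrite !(@diff_actw k) ?leq_max ?leqnn ?orbT //.
by rewrite -sumrB; apply: eq_bigr => m _; rewrite mcoeffB mulrzBr.
Qed.

Fact diff_actr_is_zmod_morphism D : zmod_morphism (diff_act D).
Proof.
move=> h h'; rewrite /diff_act -sumrB; apply: eq_bigr => m _.
by rewrite raddfB mulrzBl.
Qed.

HB.instance Definition _ D := GRing.isZmodMorphism.Build
  {mpoly rat[n]} {mpoly rat[n]} (diff_act D) (diff_actr_is_zmod_morphism D).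

Definition diff_eval h D := diff_act D h.

Fact diff_eval_is_zmod_morphism h : zmod_morphism (diff_eval h).
Proof. by move=> D D'; apply: diff_actB. Qed.

HB.instance Definition _ h := GRing.isZmodMorphism.Build
  {mpoly int[n]} {mpoly rat[n]} (diff_eval h) (diff_eval_is_zmod_morphism h).

Lemma diff_actZ D (c : rat) h : diff_act D (c *: h) = c *: diff_act D h.
Proof.
rewrite /diff_act scaler_sumr; apply: eq_bigr => m _.
by rewrite mderivmZ scalerMzr.
Qed.

Lemma diff_actX m h : diff_act 'X_[m] h = h^`M[m].
Proof. by rewrite /diff_act msuppX big_seq1 mcoeffX eqxx. Qed.

Lemma diff_actZl (c : int) D h : diff_act (c *: D) h = diff_act D h *~ c.
Proof.
rewrite -[c in LHS]intz scaler_int.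
exact: (raddfMz (diff_eval h)).
Qed.

Lemma diff_act_suml (I : Type) (r : seq I) (P : pred I)
    (F : I -> {mpoly int[n]}) h :
  diff_act (\sum_(i <- r | P i) F i) h = \sum_(i <- r | P i) diff_act (F i) h.
Proof. exact: (raddf_sum (diff_eval h)). Qed.

Lemma diff_actM D D' h : diff_act (D * D') h = diff_act D (diff_act D' h).
Proof.
rewrite {1}[D]mpolyE mulr_suml diff_act_suml [RHS]/diff_act.
apply: eq_bigr => m _; rewrite -scalerAl diff_actZl; congr (_ *~ _).
rewrite {1}[D']mpolyE mulr_sumr diff_act_suml [in RHS]/diff_act raddf_sum.
apply: eq_bigr => m' _; rewrite -scalerAr diff_actZl raddfMz; congr (_ *~ _).
by rewrite -mpolyXD diff_actX addmC mderivmDm.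
Qed.

End DiffAct.

(* d_u = \sum_i u_i d_i *)
Definition ddir (L : zlatticeType) (u : L) : diff_ring L :=
  \sum_i 'X_i *~ lcoord u ord0 i.

Lemma ddirE (L : zlatticeType) (u : L) (h : polyfun L) :
  diff_act (ddir u) h = \sum_i h^`M(i) *~ lcoord u ord0 i.
Proof.
rewrite diff_act_suml; apply: eq_bigr => i _.
by rewrite -scaler_int diff_actZl intz diff_actX mderivmU1m.
Qed.

Section RiemannRoch.
Variable L : zlatticeType.
Implicit Types f g : polyfun L.

Definition shift_ann f : {pred group_ring L} :=
  fun s => `[< forall x, shift_act s (peval f) x = 0 >].

Fact shift_ann_zmod_closed f : zmod_closed (shift_ann f).
Proof.
split=> [|s t /asboolP hs /asboolP ht]; apply/asboolP => x.
  by rewrite -(subrr 0) shift_actB subrr.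
by rewrite shift_actB hs ht subrr.
Qed.

Fact shift_ann_absorb f a s : s \in shift_ann f -> a * s \in shift_ann f.
Proof.
move=> /asboolP hs; apply/asboolP => x; rewrite shift_actM.
by rewrite (_ : shift_act s _ = fun=> 0) ?shift_act0 //; apply/funext.
Qed.

HB.instance Definition _ f :=
  GRing.isZmodClosed.Build (group_ring L) (shift_ann f) (shift_ann_zmod_closed f).
HB.instance Definition _ f :=
  isMulAbsorbing.Build (group_ring L) (shift_ann f) (@shift_ann_absorb f).

Definition diff_ann g : {pred diff_ring L} := fun D => diff_act D g == 0.

Fact diff_ann_zmod_closed g : zmod_closed (diff_ann g).
Proof.
split=> [|D D' /eqP hD /eqP hD']; apply/eqP; first exact: (raddf0 (diff_eval g)).
by rewrite diff_actB hD hD' subrr.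
Qed.

Fact diff_ann_absorb g E D : D \in diff_ann g -> E * D \in diff_ann g.
Proof. by move=> /eqP hD; apply/eqP; rewrite diff_actM hD raddf0. Qed.

HB.instance Definition _ g :=
  GRing.isZmodClosed.Build (diff_ring L) (diff_ann g) (diff_ann_zmod_closed g).
HB.instance Definition _ g :=
  isMulAbsorbing.Build (diff_ring L) (diff_ann g) (@diff_ann_absorb g).

(* K_f = Sh(L)/Ann(f), A_g = Diff(L)/Ann(g) and QA_g = Q (x) A_g. *)
Definition Kring f : comPzRingType := quot_ring (shift_ann f).
Definition Aring g : comPzRingType := quot_ring (diff_ann g).
Definition QAring g : comPzRingType := rationalization (Aring g).

(* [T^u] in K_f, and [d_u] in A_g and in QA_g *)
Definition Tcls f (u : L) : Kring f := qcls (shift_ann f) (shift u).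
Definition dcls g (u : L) : Aring g := qcls (diff_ann g) (ddir u).
Definition Qdcls g (u : L) : QAring g := iota_rat (dcls g u).

(* The image K_f^1 of L in the units of K_f. *)
Definition in_K1 f (x : Kring f) : Prop := exists u : L, x = Tcls f u.

(* [D] . g = D . g for [D] in A_g, and its extension to QA_g. *)
Definition A_act g (a : Aring g) : polyfun L :=
  diff_act (repr (a : Quotient.quot (diff_ann g))) g.

Definition QA_act g (td : QAring g) : polyfun L :=
  (fden td).+1%:R^-1 *: A_act (fnum td).

Lemma A_actE g (D : diff_ring L) : A_act (qcls (diff_ann g) D) = diff_act D g.
Proof.
have /eqP h : repr (qcls (diff_ann g) D : Quotient.quot _) - D \in diff_ann g.
  by apply/qcls_eq; rewrite /qcls reprK.
by apply/eqP; rewrite -subr_eq0 -diff_actB h.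
Qed.

Fact A_act_is_zmod_morphism g : zmod_morphism (@A_act g).
Proof.
move=> a b; have [D ->] := qcls_surj a; have [E ->] := qcls_surj b.
by rewrite -raddfB !A_actE diff_actB.
Qed.

HB.instance Definition _ g := GRing.isZmodMorphism.Build
  (Aring g) (polyfun L) (@A_act g) (@A_act_is_zmod_morphism g).

Lemma QA_actE g (a : Aring g) m :
  QA_act (frac a m : QAring g) = m.+1%:R^-1 *: A_act a.
Proof.
have [k /(congr1 (@A_act g))] := frac_repr a m.
rewrite !raddfMn -!mulrnA -!scaler_nat !natrM /QA_act => h.
have nz j : j.+1%:R != 0 :> rat by rewrite pnatr_eq0.
apply: (scalerI (nz k)); apply: (scalerI (nz m)).
apply: (scalerI (nz (fden (frac a m)))).
rewrite !scalerA; move: h; set d := (fden _).+1%:R => h.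
have e1 (x y z : rat) : x != 0 -> x * y * z / x = y * z by move=> x0; field.
have e2 (x y z : rat) : y != 0 -> x * y * z / y = x * z by move=> y0; field.
by rewrite e1 ?e2 ?nz.
Qed.

Definition homogeneous g : Prop := exists d : nat, g \is d.-homog.

Definition Riemann_Roch_pair f g : Prop :=
  homogeneous g /\ exists td : QAring g, invertible td /\ f = QA_act td.

End RiemannRoch.

(* Main.v *)
Require Import Defs.
From HB Require Import structures.
From mathcomp Require Import all_boot all_order all_algebra.
From mathcomp Require Import boolp ssrcomplements mpoly.
From mathcomp Require Import zify.

Set Implicit Arguments.
Unset Strict Implicit.
Unset Printing Implicit Defensive.

Import GRing.Theory Num.Theory.
Local Open Scope ring_scope.

(* By Taylor's formula T^u acts on polynomials as exp(d_u). As td is a unit and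
   g is homogeneous, s = sum_u n_u T^u kills f if and only if all power sums
   p_k = sum_u n_u d_u^k kill g. Each of the four maps is prod_u F(a_u)^(n_u)
   for some series F with F(0) = 1, and it is trivial on Ann(f) because its
   logarithm is a combination of power sums of the a_u: these are the p_k for
   the Chern and Todd maps, and for lambda, where a_u = T^u, they are the
   Adams operations sum_u n_u T^(ku), which kill f because they replace p_j by
   k^j p_j. For the determinant, p_1 = d_w with w = sum_u n_u u, so T^w acts
   trivially on f. Logarithmic derivatives in R[[t]] replace logarithms. *)

(** * Unit groups in additive notation; maps out of quotients of a group ring *)

Section UnitPair.
Variable R : comPzRingType.

(* The group of units of R written additively, so that [glift] applies to it. *)
Definition unit_pair : Type := {p : R * R | p.1 * p.2 == 1}.
HB.instance Definition _ := Choice.on unit_pair.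
Implicit Types p q r : unit_pair.

Definition uval p : R := (val p).1.
Definition uinv p : R := (val p).2.

Lemma uvalK p : uval p * uinv p = 1.
Proof. exact/eqP/(valP p). Qed.

Definition upair (x y : R) (xy1 : x * y = 1) : unit_pair :=
  exist _ (x, y) (introT eqP xy1).

Lemma unit_pair_inj p q : uval p = uval q -> p = q.
Proof.
move=> epq; have einv : uinv p = uinv q.
  by rewrite -[LHS]mul1r -(uvalK q) -epq mulrAC uvalK mul1r.
by apply: val_inj; rewrite (surjective_pairing (val p)) [RHS]surjective_pairing;
   congr pair.
Qed.

Definition upair_zero := upair (mulr1 (1 : R)).

Fact upair_add_proof p q : uval p * uval q * (uinv p * uinv q) = 1.
Proof. by rewrite mulrACA !uvalK mulr1. Qed.
Definition upair_add p q := upair (upair_add_proof p q).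

Fact upair_opp_proof p : uinv p * uval p = 1.
Proof. by rewrite mulrC uvalK. Qed.
Definition upair_opp p := upair (upair_opp_proof p).

Fact upair_addA : associative upair_add.
Proof. by move=> p q r; apply: unit_pair_inj; apply: mulrA. Qed.
Fact upair_addC : commutative upair_add.
Proof. by move=> p q; apply: unit_pair_inj; apply: mulrC. Qed.
Fact upair_add0 : left_id upair_zero upair_add.
Proof. by move=> p; apply: unit_pair_inj; apply: mul1r. Qed.
Fact upair_addN : left_inverse upair_zero upair_opp upair_add.
Proof. by move=> p; apply: unit_pair_inj; apply: upair_opp_proof. Qed.

HB.instance Definition _ := GRing.isZmodule.Build unit_pair
  upair_addA upair_addC upair_add0 upair_addN.

Lemma uval0 : uval 0 = 1. Proof. by []. Qed.
Lemma uvalD p q : uval (p + q) = uval p * uval q. Proof. by []. Qed.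
Lemma uvalN p : uval (- p) = uinv p. Proof. by []. Qed.
Lemma uval_invertible p : invertible (uval p).
Proof. by exists (uinv p); apply: uvalK. Qed.

(** Universal property of the group ring modulo [I]: only the triviality of the products over
    elements of [I] remains to be checked. *)
Lemma unit_hom_quot (L : zmodType) (I : pzIdeal (group_ring L))
    (h : L -> unit_pair) :
  (forall s, s \in I -> glift h s = 0) ->
  exists phi : quot_ring I -> R,
    unit_hom phi /\ forall s, phi (qcls I s) = uval (glift h s).
Proof.
move=> hI; pose phi (a : quot_ring I) :=
  uval (glift h (repr (a : Quotient.quot I))).
have phiE s : phi (qcls I s) = uval (glift h s).
  rewrite /phi; congr uval; apply/eqP; rewrite -subr_eq0 -raddfB; apply/eqP.
  by apply: hI; apply/qcls_eq; rewrite /qcls generic_quotient.reprK.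
exists phi; split=> //; split=> [x|x y]; first exact: uval_invertible.
have [s ->] := qcls_surj x; have [t ->] := qcls_surj y.
by rewrite -raddfD !phiE raddfD uvalD.
Qed.

End UnitPair.

(** Lets the factors n + 1 of a formal derivative be cancelled. *)
Definition torsion_free (V : zmodType) : Prop :=
  forall (x : V) n, x *+ n.+1 = 0 -> x = 0.

Lemma mulr_glift (L : zmodType) (R : comPzRingType) (h : L -> R) x s :
  x * glift h s = glift (fun u => x * h u) s.
Proof. by rewrite mulr_sumr; apply: eq_bigr => u _; rewrite mulrzAr. Qed.

(** * Logarithmic derivatives and values at t = 1 of power series *)

Section Series.
Variable R : comPzRingType.
Implicit Types F G H : pseries R.

Definition ps_coef k F : R := F k.

Fact ps_coef_is_zmod_morphism k : zmod_morphism (ps_coef k).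
Proof. by []. Qed.

HB.instance Definition _ k := GRing.isZmodMorphism.Build
  (pseries R) R (ps_coef k) (ps_coef_is_zmod_morphism k).

Definition ps_deriv F : pseries R := fun n => F n.+1 *+ n.+1.

Lemma ps_derivM F G : ps_deriv (F * G) = ps_deriv F * G + F * ps_deriv G.
Proof.
apply/funext=> n; rewrite -[RHS]/(_ n + _ n) !ps_mul_coef /ps_deriv.
rewrite ps_mul_coef -sumrMnl.
(* The factor n + 1 splits as i + (n + 1 - i). *)
transitivity (\sum_(i < n.+2) (F i * G (n.+1 - i)%N *+ i)
  + \sum_(i < n.+2) (F i * G (n.+1 - i)%N *+ (n.+1 - i))).
  rewrite -big_split /=; apply: eq_bigr => i _.
  by rewrite -mulrnDr subnKC // -ltnS.
congr (_ + _).
  rewrite big_ord_recl mulr0n add0r; apply: eq_bigr => i _.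
  by rewrite /= subSS mulrnAl.
rewrite big_ord_recr /= subnn mulr0n addr0; apply: eq_bigr => i _.
by rewrite -mulrnAr subSn // -ltnS.
Qed.

Definition dlog (p : unit_pair (pseries R)) : pseries R :=
  ps_deriv (uval p) * uinv p.

Fact dlog_is_zmod_morphism : zmod_morphism dlog.
Proof.
move=> p q; rewrite /dlog uvalD ps_derivM uvalN.
have d0 : ps_deriv 1 = 0 :> pseries R by apply/funext=> n; apply: mul0rn.
(* Differentiate the identity [uval q * uinv q = 1]. *)
have qd : ps_deriv (uinv q) * uval q = - (ps_deriv (uval q) * uinv q).
  apply/eqP; rewrite -addr_eq0 addrC (mulrC (ps_deriv (uinv q))) -ps_derivM.
  by rewrite uvalK d0.
rewrite -[uinv (p - q)]/(uinv p * uval q) mulrDl mulrACA (mulrC (uinv q)) uvalK.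
by rewrite mulr1 mulrACA uvalK mul1r qd.
Qed.

HB.instance Definition _ := GRing.isZmodMorphism.Build
  (unit_pair (pseries R)) (pseries R) dlog dlog_is_zmod_morphism.

(** The derivative is [dlog p] times the series, hence zero; without torsion only the constant term
    survives. *)
Lemma dlog_eq0 (p : unit_pair (pseries R)) :
  torsion_free R -> dlog p = 0 -> uval p 0%N = 1 -> p = 0.
Proof.
move=> tfR dp0 p01; apply: unit_pair_inj; rewrite uval0.
have d0 : ps_deriv (uval p) = 0.
  by rewrite -[LHS]mulr1 -(uvalK p) (mulrC (uval p)) mulrA -/(dlog p) dp0 mul0r.
apply/funext => -[|n]; first by rewrite p01.
exact: (tfR _ n (congr1 (fun F : pseries R => F n) d0)).
Qed.

Fact ps_coef0M F G : (F * G) 0%N = F 0%N * G 0%N.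
Proof. by rewrite ps_mul_coef big_ord1. Qed.

Fact ps_coef0_unit (p : unit_pair (pseries R)) : uval p 0%N * uinv p 0%N = 1.
Proof. by rewrite -ps_coef0M uvalK. Qed.

Definition unit_coef0 p : unit_pair R := upair (ps_coef0_unit p).

Fact unit_coef0_is_zmod_morphism : zmod_morphism unit_coef0.
Proof. by move=> p q; apply: unit_pair_inj; apply: ps_coef0M. Qed.

HB.instance Definition _ := GRing.isZmodMorphism.Build
  (unit_pair (pseries R)) (unit_pair R) unit_coef0 unit_coef0_is_zmod_morphism.

(* The value at t = 1 of a series that is in fact a polynomial. *)
Definition ps_sum_is F (a : R) : Prop :=
  exists N, (forall k, (N <= k)%N -> F k = 0) /\ a = \sum_(k < N) F k.

Lemma sum_coef_wide F N M : (N <= M)%N ->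
  (forall k, (N <= k)%N -> F k = 0) -> \sum_(k < M) F k = \sum_(k < N) F k.
Proof.
move=> leNM F0; rewrite (big_ord_widen M F leNM) [RHS]big_mkcond.
by apply: eq_bigr => k _; case: ltnP => // /F0.
Qed.

Lemma ps_sum_is_unique F a b : ps_sum_is F a -> ps_sum_is F b -> a = b.
Proof.
move=> [N [FN ->]] [M [FM ->]].
rewrite -(sum_coef_wide (leq_maxl N M) FN).
exact: sum_coef_wide (leq_maxr N M) FM.
Qed.

Lemma ps_sum_is1 : ps_sum_is 1 1.
Proof. by exists 1%N; split=> [[]|] //; rewrite big_ord1. Qed.

(** Both sides are the sum of F_i G_j over i + j < N + M, as F_i G_j vanishes unless i < N and j <
    M. *)
Lemma ps_sum_isM F G a b :
  ps_sum_is F a -> ps_sum_is G b -> ps_sum_is (F * G) (a * b).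
Proof.
move=> [N [FN ->]] [M [GM ->]]; exists (N + M)%N; split=> [k leNMk|].
  rewrite ps_mul_coef big1 // => i _.
  have [/FN ->|ltiN] := leqP N i; first by rewrite mul0r.
  by rewrite GM ?mulr0 //; lia.
rewrite big_distrlr /=.
transitivity (\sum_(i < N + M) \sum_(j < N + M | (i + j < N + M)%N) F i * G j).
  rewrite (big_ord_widen (N + M) (fun i => \sum_(j < M) F i * G j)) ?leq_addr //.
  rewrite big_mkcond; apply: eq_bigr => i _ /=; case: ltnP => [ltiN|/FN Fi0].
    rewrite (big_ord_widen (N + M) (fun j => F i * G j)) ?leq_addl //.
    rewrite [LHS]big_mkcond [RHS]big_mkcond; apply: eq_bigr => j _ /=.
    case: ltnP => [ltjM|/GM ->]; last by rewrite mulr0 if_same.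
    by rewrite ifT //; lia.
  by rewrite big1 // => j _; rewrite Fi0 mul0r.
transitivity (\sum_(k < N + M) \sum_(i < N + M | (i <= k)%N) F i * G (k - i)%N).
  rewrite [RHS](exchange_big_dep predT) //=; apply: eq_bigr => i _.
  have leiM : (i <= N + M)%N by apply: ltnW.
  transitivity (\sum_(j < N + M - i) F i * G j).
    rewrite (big_ord_widen (N + M) (fun j => F i * G j)) ?leq_subr //.
    by apply: eq_bigl => j; rewrite ltn_subRL.
  rewrite -(big_mkord (fun k => (i <= k)%N) (fun k => F i * G (k - i)%N)).
  rewrite (big_cat_nat (leq0n i) leiM) /= [X in _ = X + _]big_nat_cond.
  rewrite [X in _ = X + _]big1 ?add0r => [|k]; last first.
    by move=> /andP[/andP[_ ltki]]; rewrite leqNgt ltki.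
  rewrite -[X in \sum_(X <= _ < _ | _) _]add0n big_addn big_mkord.
  by apply: eq_big => k; rewrite ?leq_addl ?addnK.
apply: eq_bigr => k _; rewrite ps_mul_coef.
by rewrite (big_ord_widen (N + M) (fun i => F i * G (k - i)%N)).
Qed.

End Series.

(** * Products of series F(a_u t), and their values at t = 1 for nilpotent a_u *)

Section Substitution.
Variables (S R : comPzRingType) (j : {rmorphism S -> R}).
Implicit Types (F G : pseries S) (a : R).

Definition ps_subst a F : pseries R := fun k => j (F k) * a ^+ k.

Lemma ps_subst1 a : ps_subst a 1 = 1.
Proof. by apply/funext => -[|k]; rewrite /ps_subst /= (rmorph1, rmorph0) ?mulr1 ?mul0r. Qed.

Lemma ps_substM a F G : ps_subst a (F * G) = ps_subst a F * ps_subst a G.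
Proof.
apply/funext=> k; rewrite /ps_subst !ps_mul_coef rmorph_sum mulr_suml.
apply: eq_bigr => i _; rewrite rmorphM mulrACA -exprD subnKC //.
by rewrite -ltnS.
Qed.

Lemma ps_subst_sum_is a F N : a ^+ N = 0 ->
  ps_sum_is (ps_subst a F) (\sum_(k < N) ps_subst a F k).
Proof.
move=> aN0; exists N; split=> // k leNk.
by rewrite /ps_subst -(subnK leNk) exprD aN0 !mulr0.
Qed.

Variables (F G : pseries S) (FG1 : F * G = 1).

Fact ps_subst_unit a : ps_subst a F * ps_subst a G = 1.
Proof. by rewrite -ps_substM FG1 ps_subst1. Qed.

Definition usubst a : unit_pair (pseries R) := upair (ps_subst_unit a).

(** For nilpotent a the mutually inverse series F(a t) and G(a t) are polynomials, so they can be
    evaluated at t = 1. *)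
Fact usubst_at1_proof a N : a ^+ N = 0 ->
  (\sum_(k < N) ps_subst a F k) * (\sum_(k < N) ps_subst a G k) = 1.
Proof.
move=> aN0; apply: ps_sum_is_unique (ps_sum_is1 R).
rewrite -(ps_subst_unit a).
by apply: ps_sum_isM; apply: ps_subst_sum_is.
Qed.

Definition usubst_at1 a N (aN0 : a ^+ N = 0) : unit_pair R :=
  upair (usubst_at1_proof aN0).

(** Chain rule: the result is a (F'/F)(a t) with F'/F = F' G; the extra factor a shifts the exponent
    to k + 1. *)
Lemma dlog_usubst a :
  dlog (usubst a) = fun k => j ((ps_deriv F * G) k) * a ^+ k.+1.
Proof.
apply/funext=> k; rewrite /dlog !ps_mul_coef rmorph_sum mulr_suml.
apply: eq_bigr => i _; rewrite -[uinv _]/(ps_subst a G) /ps_subst /ps_deriv.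
rewrite -[uval _]/(ps_subst a F) /ps_subst rmorphM rmorphMn /=.
by rewrite -mulrnAl mulrACA -exprD addSn subnKC // -ltnS.
Qed.

Variables (L : zmodType) (a : L -> R) (s : group_ring L).
Hypotheses (tfR : torsion_free R) (F0 : F 0%N = 1).
Hypothesis power_sums0 : forall k, glift (fun u => a u ^+ k.+1) s = 0.

(* The logarithmic derivative of prod_u F(a_u t)^(n_u) is a combination of
   the power sums sum_u n_u a_u^k. *)
Lemma prod_usubst_eq1 : glift (fun u => usubst (a u)) s = 0.
Proof.
apply: dlog_eq0 => //.
  rewrite (raddf_glift (@dlog R)); apply/funext => k.
  rewrite -[LHS]/(ps_coef k _) raddf_glift.
  transitivity (j ((ps_deriv F * G) k) * glift (fun u => a u ^+ k.+1) s).
    rewrite mulr_glift; apply: eq_glift => u.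
    by rewrite -[LHS]/(dlog _ k) dlog_usubst.
  by rewrite power_sums0 mulr0.
(* The logarithmic derivative does not see the constant term, which is a product of powers of F(0) =
   1. *)
suff /(congr1 (@uval R)) e : unit_coef0 (glift (fun u => usubst (a u)) s) = 0.
  exact: e.
rewrite (raddf_glift (@unit_coef0 R)) /glift big1 // => u _.
rewrite [X in X *~ _](_ : _ = 0) ?mul0rz //; apply: unit_pair_inj.
by rewrite -[LHS]/(j (F 0%N) * a u ^+ 0) F0 rmorph1 mulr1.
Qed.

Variables (N : nat) (aN0 : forall u, a u ^+ N = 0).

(** Evaluate [prod_usubst_eq1] at t = 1. Not every series has such a value, so evaluation passes
    through [glift] as a relation. *)
Lemma prod_usubst_at1_eq1 : glift (fun u => usubst_at1 (aN0 u)) s = 0.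
Proof.
(* Including the inverses makes the relation stable under negation. *)
pose sum_is (P : unit_pair (pseries R)) (c : unit_pair R) :=
  ps_sum_is (uval P) (uval c) /\ ps_sum_is (uinv P) (uinv c).
have isD P Q c d : sum_is P c -> sum_is Q d -> sum_is (P + Q) (c + d).
  by move=> [P1 P2] [Q1 Q2]; split; apply: ps_sum_isM.
have isN P c : sum_is P c -> sum_is (- P) (- c) by case.
have is0 : sum_is 0 0 by split; apply: ps_sum_is1.
have isMn P c n : sum_is P c -> sum_is (P *+ n) (c *+ n).
  by move=> Pc; elim: n => // n IHn; rewrite !mulrSr; apply: isD.
have isMz P c n : sum_is P c -> sum_is (P *~ n) (c *~ n).
  by move=> Pc; case: n => n; [|apply: isN]; apply: isMn.
have [h _] : sum_is (glift (fun u => usubst (a u)) s)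
                    (glift (fun u => usubst_at1 (aN0 u)) s).
  apply: (big_ind2 sum_is) => // [P c Q d|u _]; first exact: isD.
  by apply: isMz; split; apply: ps_subst_sum_is.
apply: unit_pair_inj; apply: (ps_sum_is_unique h).
by rewrite prod_usubst_eq1; apply: ps_sum_is1.
Qed.

End Substitution.

Lemma ps_one_addX_inv :
  (1 + psX) * (fun k => (-1) ^+ k : int) = 1 :> pseries int.
Proof.
rewrite mulrDl mul1r; apply/funext => -[|k]; rewrite -[LHS]/(_ + _) ps_mul_coef.
  by rewrite big_ord1 mul0r addr0.
rewrite big_ord_recl mul0r add0r big_ord_recl big1 ?addr0 => [|i _].
  by rewrite mul1r subSS subn0 exprS mulN1r addNr.
by rewrite mul0r.
Qed.

(** * Polynomial functions on the lattice and Taylor's formula *)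

Lemma mpoly_ring_ind n (R : comNzRingType) (P : {mpoly R[n]} -> Prop) :
  (forall c, P c%:MP) -> (forall i, P 'X_i) ->
  (forall p q, P p -> P q -> P (p + q)) ->
  (forall p q, P p -> P q -> P (p * q)) -> forall p, P p.
Proof.
move=> PC PX PD PM p; have P1 : P 1 by rewrite -mpolyC1.
have P0 : P 0 by rewrite -mpolyC0.
rewrite [p]mpolyE; apply: (big_ind P P0 PD) => m _; rewrite -mul_mpolyC.
apply: (PM) => //; rewrite mpolyXE_id; apply: (big_ind P P1 PM) => i _.
by elim: (m i) => [|k IHk]; rewrite ?expr0 // exprS; apply: (PM).
Qed.

Lemma mnm_neq0 n (m : 'X_{1..n}) : m != 0%MM -> exists i, m i != 0%N.
Proof.
move=> m0; apply/existsP; apply: contraR m0; rewrite negb_exists => /forallP h.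
by apply/eqP/mnmP=> i; rewrite mnm0E; apply/eqP; rewrite -[_ == _]negbK h.
Qed.

Lemma meval_at0 n (R : comNzRingType) (p : {mpoly R[n]}) :
  p.@[fun=> 0] = p@_0%MM.
Proof.
rewrite [p]mpolyE !raddf_sum; apply: eq_bigr => m _ /=.
rewrite mevalZ mcoeffZ mevalX mcoeffX; congr (_ * _).
have [->|m0] := eqVneq m 0%MM.
  by rewrite big1 // => i _; rewrite mnm0E.
have [i mi] := mnm_neq0 m0.
by rewrite (bigD1 i) //= expr0n (negPf mi) mul0r.
Qed.

Section Taylor.
Variable L : zlatticeType.
Implicit Types (x u : L) (h : polyfun L).

HB.instance Definition _ := GRing.isZmodMorphism.Build L 'rV[int]_(lrank L)
  (@lcoord L) (@lcoord_is_zmod_morphism L).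

(** The restriction of h to the line x + t u, as a polynomial in t. *)
Definition along x u h : {poly rat} :=
  mmap (@polyC rat)
    (fun i => (lcoord x ord0 i)%:~R%:P + (lcoord u ord0 i)%:~R *: 'X) h.

Lemma horner_along x u h m : (along x u h).[m%:R] = peval h (x + u *+ m).
Proof.
elim/mpoly_ring_ind: h => [c|i|p q IHp IHq|p q IHp IHq].
- by rewrite /along mmapC hornerC /peval mevalC.
- rewrite /along mmapX mmap1U /peval mevalXU !hornerE raddfD raddfMn /=.
  by rewrite !mxE rmorphD /= mulmxnE rmorphMn /= mulr_natr.
- by rewrite /along mmapD hornerD IHp IHq /peval mevalD.
- by rewrite /along rmorphM /= hornerM IHp IHq /peval mevalM.
Qed.

(** Both sides obey the Leibniz rule, so constants and variables suffice. *)
Lemma deriv_along x u h : (along x u h)^`() = along x u (diff_act (ddir u) h).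
Proof.
have alongD p q : along x u (p + q) = along x u p + along x u q.
  exact: mmapD.
have alongM p q : along x u (p * q) = along x u p * along x u q.
  exact: rmorphM.
have actM p q : diff_act (ddir u) (p * q)
    = diff_act (ddir u) p * q + p * diff_act (ddir u) q.
  rewrite !ddirE mulr_suml mulr_sumr -big_split; apply: eq_bigr => i _ /=.
  by rewrite mderivM mulrzDl mulrzAl mulrzAr.
elim/mpoly_ring_ind: h => [c|i|p q IHp IHq|p q IHp IHq].
- rewrite {1}/along mmapC derivC ddirE big1 ?[RHS]raddf0 // => j _.
  by rewrite mderivC mul0rz.
- rewrite {1}/along mmapX mmap1U derivD derivC derivZ derivX add0r.
  rewrite ddirE (bigD1 i) //= big1 ?addr0 => [|j ji].
    rewrite mderivX mnm1E eqxx scale1r -[X in (X - _)%MM]add0m addmK mpolyX0.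
    by rewrite /along -mpolyC1 -rmorphMz mmapC /= -alg_polyC.
  by rewrite mderivX mnm1E eq_sym (negPf ji) scale0r mul0rz.
- by rewrite alongD derivD IHp IHq raddfD alongD.
- by rewrite alongM derivM IHp IHq actM alongD !alongM.
Qed.

Lemma derivn_along x u h k :
  (along x u h)^`(k) = along x u (diff_act (ddir u ^+ k) h).
Proof.
elim: k => [|k IHk]; last by rewrite derivnS IHk deriv_along -diff_actM -exprS.
by rewrite expr0 -mpolyX0 diff_actX mderivm0m.
Qed.

(** Univariate Taylor expansion at t = 0 of the restriction to x + t u, evaluated at t = 1. *)
Lemma taylor x u h N : diff_act (ddir u ^+ N) h = 0 ->
  peval h (x + u) = \sum_(k < N) k`!%:R^-1 * peval (diff_act (ddir u ^+ k) h) x.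
Proof.
(* The N-th derivative of the restriction is zero, which over the rationals bounds its degree. *)
move=> hN; have sizeN : (size (along x u h) <= N)%N.
  apply/leq_sizeP => k leNk.
  have /(congr1 (fun p : {poly rat} => p`_(k - N))) := derivn_along x u h N.
  rewrite hN [along _ _ 0]raddf0 coef0 coef_derivn subnKC // => /eqP.
  by rewrite mulrn_eq0 -leqn0 leqNgt ffact_gt0 leNk /= => /eqP.
rewrite -[u in LHS]mulr1n -horner_along -[1%:R]add0r.
rewrite (nderiv_taylor_wide (mulrC _ _) sizeN); apply: eq_bigr => k _.
rewrite expr1n mulr1 -[x in RHS]addr0 -(mulr0n u) -horner_along -derivn_along.
rewrite nderivn_def hornerMn -[X in _ * X]mulr_natl mulKf //.
by rewrite pnatr_eq0 -lt0n fact_gt0.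
Qed.

(** Induction on the degree of m: the partial derivatives of h also vanish on the lattice, and m_i
    times the coefficient of m in h is a coefficient of the i-th one in lower degree. *)
Lemma peval_inj h : (forall x, peval h x = 0) -> h = 0.
Proof.
move=> h0; apply/mpolyP => m; rewrite mcoeff0.
move: {2}(mdeg m) (erefl (mdeg m)) => d.
elim: d m h h0 => [|d IHd] m h h0 md.
  move/eqP: md; rewrite mdeg_eq0 => /eqP->; rewrite -meval_at0 -(h0 0).
  by apply: meval_eq => i; rewrite raddf0 mxE.
have [i mi] : exists i, m i != 0%N.
  by apply: mnm_neq0; rewrite -mdeg_eq0 md.
have le_im : (U_(i) <= m)%MM.
  by apply/mnm_lepP => j; rewrite mnm1E; case: eqP => // <-; rewrite lt0n.
have dm : m = (m - U_(i) + U_(i))%MM by rewrite submK.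
have d0 x : peval h^`M(i) x = 0.
  have [v _ vK] := @lcoord_bij L; pose u := v (delta_mx ord0 i).
  have -> : h^`M(i) = diff_act (ddir u) h.
    rewrite ddirE (bigD1 i) //= big1 => [|j ji]; rewrite /u vK mxE eqxx ?eqxx.
      by rewrite addr0.
    by rewrite (negPf ji).
  (* Every natural number t is a root, which is more roots than a nonzero polynomial allows. *)
  have along0 : along x u h = 0.
    apply: (@roots_geq_poly_eq0 _ _ [seq k%:R | k <- iota 0 (size (along x u h))]).
    - by apply/allP=> _ /mapP[k _ ->]; rewrite /root horner_along h0.
    - by rewrite map_inj_uniq ?iota_uniq //; apply: mulrIn; rewrite oner_eq0.
    - by rewrite size_map size_iota.
  rewrite -[x]addr0 -(mulr0n u) -horner_along -deriv_along along0.
  by rewrite linear0 horner0.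
have md' : mdeg (m - U_(i))%MM = d.
  by apply: succn_inj; rewrite -md [in RHS]dm mdegD mdeg1 addn1.
by have /eqP := IHd _ _ d0 md'; rewrite mcoeff_mderiv -dm mulrn_eq0 => /eqP.
Qed.

Lemma dhomog_ddir u h d : h \is d.+1.-homog -> diff_act (ddir u) h \is d.-homog.
Proof.
move=> hd; rewrite ddirE; apply: rpred_sum => i _; apply: rpredMz.
apply/dhomogP => m; rewrite mcoeff_msupp mcoeff_mderiv mulrn_eq0 /= => hm.
have := dhomogP _ _ _ hd (m + U_(i))%MM; rewrite mcoeff_msupp => /(_ hm) /=.
by rewrite mdegD mdeg1 addn1 => -[].
Qed.

Lemma ddir_dhomog0 u h : h \is 0.-homog -> diff_act (ddir u) h = 0.
Proof.
move=> hd; rewrite ddirE big1 // => i _; rewrite [_^`M(i)](_ : _ = 0) ?mul0rz //.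
apply/mpolyP=> m; rewrite mcoeff_mderiv mcoeff0 (dhomog_nemf_coeff hd) ?mul0rn //=.
by rewrite mdegD mdeg1 addn1.
Qed.

Lemma dhomog_ddirX u h d k : (k <= d)%N -> h \is d.-homog ->
  diff_act (ddir u ^+ k) h \is (d - k).-homog.
Proof.
move=> lekd hd; elim: k lekd => [|k IHk] ltkd.
  by rewrite subn0 expr0 -mpolyX0 diff_actX mderivm0m.
rewrite exprS diff_actM; apply: dhomog_ddir.
by rewrite subnSK // IHk // ltnW.
Qed.

(** Each d_u lowers the degree by one and kills constants. This gives a nilpotency exponent common
    to all u. *)
Lemma ddirX_dhomog u h d k : h \is d.-homog -> (d < k)%N ->
  diff_act (ddir u ^+ k) h = 0.
Proof.
move=> hd ltdk; rewrite -(subnK ltdk) exprD diff_actM exprS diff_actM.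
rewrite (@ddir_dhomog0 u) ?raddf0 //.
by have := dhomog_ddirX u (leqnn d) hd; rewrite subnn.
Qed.

End Taylor.

(** * Torsion-freeness, and Ann(f) described by power sums *)

Lemma qcls_eq0 (R : comPzRingType) (I : pzIdeal R) x :
  qcls I x = 0 <-> x \in I.
Proof. by rewrite -[0 in X in X <-> _](raddf0 (qcls I)) qcls_eq subr0. Qed.

Lemma rationalization_torsion_free (R : comPzRingType) :
  torsion_free (rationalization R).
Proof.
move=> x n xn0; have n0 : n.+1%:R != 0 :> rat by rewrite pnatr_eq0.
rewrite -[x]mulr1 -(rmorph1 (@rat_const R)) -(divff n0) rmorphM rmorph_nat.
by rewrite mulrA mulr_natr xn0 mul0r.
Qed.

Lemma shiftMn (L : zmodType) (u : L) k : shift (u *+ k) = shift u ^+ k.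
Proof.
by elim: k => [|k IHk]; rewrite ?mulr0n // mulrS exprS shiftD IHk.
Qed.

Fact ddir_is_zmod_morphism (L : zlatticeType) : zmod_morphism (@ddir L).
Proof.
move=> u v; rewrite /ddir -sumrB; apply: eq_bigr => i _.
by rewrite raddfB !mxE mulrzBr.
Qed.

HB.instance Definition _ (L : zlatticeType) := GRing.isZmodMorphism.Build
  L (diff_ring L) (@ddir L) (@ddir_is_zmod_morphism L).

Section RiemannRochPair.
Variable L : zlatticeType.
Implicit Types (f g : polyfun L) (s : group_ring L) (u : L).

(** Ann(g) is the kernel of the action on g; thus A_g embeds into a rational vector space and has no
    torsion. *)
Lemma A_act_inj g : injective (@A_act L g).
Proof.
move=> a b; have [D ->] := qcls_surj a; have [E ->] := qcls_surj b.
rewrite !A_actE => eDE; apply/qcls_eq.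
by apply/eqP; rewrite diff_actB eDE subrr.
Qed.

Lemma Aring_torsion_free g : torsion_free (Aring g).
Proof.
move=> a n /(congr1 (@A_act L g)) /eqP; rewrite raddf0 raddfMn /=.
rewrite -scaler_nat scaler_eq0 pnatr_eq0 /= => /eqP a0.
by apply: A_act_inj; rewrite a0 raddf0.
Qed.

Lemma Kring_torsion_free f : torsion_free (Kring f).
Proof.
move=> a n; have [s ->] := qcls_surj a; rewrite -raddfMn => /qcls_eq0/asboolP h.
apply/qcls_eq0/asboolP=> x; have /eqP := h x.
by rewrite /shift_act raddfMn mulrn_eq0 => /eqP.
Qed.

Lemma dclsMn g u k : dcls g (u *+ k) = dcls g u *+ k.
Proof. by rewrite /dcls !raddfMn. Qed.

Lemma dcls_nilpotent g d u N : g \is d.-homog -> (d < N)%N -> dcls g u ^+ N = 0.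
Proof.
move=> gd ltdN; rewrite /dcls -rmorphXn; apply/qcls_eq0/eqP.
exact: ddirX_dhomog gd ltdN.
Qed.

Lemma glift_dclsX g s k :
  glift (fun u => dcls g u ^+ k) s
    = qcls (diff_ann g) (glift (fun u => ddir u ^+ k) s).
Proof. by rewrite raddf_glift; apply: eq_glift => u; rewrite /dcls -rmorphXn. Qed.

(** Apply Taylor's formula to each T^u: homogeneity of g stops it at k = d, and c D commutes with
    the powers of d_u. *)
Lemma shift_actE f g d (D : diff_ring L) (c : rat) s x : g \is d.-homog ->
  f = c *: diff_act D g ->
  shift_act s (peval f) x = c * peval (diff_act D (\sum_(k < d.+1)
    k`!%:R^-1 *: diff_act (glift (fun u => ddir u ^+ k) s) g)) x.
Proof.
move=> gd ->.
have actC E : diff_act E (c *: diff_act D g) = c *: diff_act D (diff_act E g).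
  by rewrite diff_actZ -!diff_actM mulrC.
rewrite /shift_act; transitivity (glift (fun u => \sum_(k < d.+1)
    k`!%:R^-1 * (c * peval (diff_act D (diff_act (ddir u ^+ k) g)) x)) s).
  apply: eq_glift => u; rewrite (@taylor _ _ _ _ d.+1).
    by apply: eq_bigr => k _; rewrite actC {1}/peval mevalZ.
  by rewrite actC (ddirX_dhomog _ gd) ?raddf0 ?scaler0.
rewrite /glift; under eq_bigr do rewrite mulrz_suml.
rewrite exchange_big raddf_sum /peval raddf_sum mulr_sumr /=.
apply: eq_bigr => k _; rewrite diff_actZ mevalZ mulrCA.
rewrite -[diff_act (\sum_(i <- _) _) g]/(diff_eval g (glift _ s)) raddf_glift.
by rewrite (raddf_glift (diff_act D)) (raddf_glift (meval _)) !mulr_glift.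
Qed.

(* T^u acts as exp(d_u), and td commutes with all operators, so s kills f iff
   sum_u n_u exp(d_u) kills g; the components of different degrees of the
   latter vanish separately. *)
Lemma shift_annP f g s : Riemann_Roch_pair f g ->
  s \in shift_ann f <-> forall k, glift (fun u => dcls g u ^+ k) s = 0.
Proof.
move=> [[d gd] [td [[td' tdK] f_td]]].
have [D eD] := qcls_surj (fnum td); have [D' eD'] := qcls_surj (fnum td').
have fE : f = (fden td).+1%:R^-1 *: diff_act D g by rewrite f_td /QA_act eD A_actE.
have powE k : glift (fun u => dcls g u ^+ k) s = 0 <->
    diff_act (glift (fun u => ddir u ^+ k) s) g = 0.
  by rewrite glift_dclsX qcls_eq0; split=> [/eqP|/eqP].
pose W k := diff_act (glift (fun u => ddir u ^+ k) s) g.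
pose V := \sum_(k < d.+1) k`!%:R^-1 *: W k.
split=> [/asboolP sf k|h]; last first.
  apply/asboolP=> x; rewrite (shift_actE _ _ gd fE) big1 => [|k _].
    by rewrite raddf0 /peval meval0 mulr0.
  by have /powE -> := h k; rewrite scaler0.
(* Clear denominators in td td' = 1: N is the product of the two denominators. The factor l + 1
   comes from equality of fractions and cancels. *)
have [N N0 DN] : exists2 N : rat, N != 0 & diff_act (D' * D) g = N *: g.
  move: tdK; rewrite -(fracK td) -(fracK td') fracM => /frac_eq[l].
  rewrite !mulr1n eD eD' -rmorphM => /(congr1 (@A_act L g)).
  rewrite !raddfMn /= A_actE -[1]/(qcls (diff_ann g) 1) A_actE.
  rewrite -mpolyX0 diff_actX mderivm0m -!mulrnA -!scaler_nat mulrC => e.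
  exists (((dmul (fden td) (fden td')).+1 * l.+1)%:R / l.+1%:R).
    by rewrite mulf_neq0 ?invr_eq0 ?pnatr_eq0.
  apply: (@scalerI _ _ l.+1%:R); first by rewrite pnatr_eq0.
  by rewrite scalerA mulrCA divff ?pnatr_eq0 // mulr1 -e.
have DV0 : diff_act D V = 0.
  apply: peval_inj => x; have /eqP := sf x; rewrite (shift_actE _ _ gd fE).
  by rewrite mulf_eq0 invr_eq0 pnatr_eq0 => /eqP.
(* V arises from g by operators commuting with D' D, so D' D multiplies V by N too. *)
have V0 : V = 0.
  apply: (scalerI N0); rewrite scaler0.
  transitivity (diff_act D' (diff_act D V)); last by rewrite DV0 raddf0.
  rewrite -diff_actM /V scaler_sumr [RHS]raddf_sum; apply: eq_bigr => j _.
  by rewrite /= diff_actZ scalerA (mulrC N) -scalerA /W -diff_actM mulrC diff_actM DN diff_actZ.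
have WE j : W j = glift (fun u => diff_act (ddir u ^+ j) g) s.
  exact: (raddf_glift (diff_eval g)).
apply/powE; rewrite -/(W k); have [lekd|ltdk] := leqP k d; last first.
  by rewrite WE /glift big1 // => u _; rewrite (ddirX_dhomog _ gd) ?mul0rz.
have Whom j : (j <= d)%N -> W j \is (d - j).-homog.
  move=> lejd; rewrite WE; apply: rpred_sum => u _.
  by apply/rpredMz/dhomog_ddirX.
(* The summands of V have distinct degrees d - j; projection to degree d - k isolates the k-th. *)
have := congr1 (pihomog mdeg (d - k)) V0.
rewrite pihomog0 raddf_sum (bigD1 (Ordinal (lekd : (k < d.+1)%N))) //=.
rewrite big1 ?addr0 => [|j jk]; last first.
  have lejd : (j <= d)%N by rewrite -ltnS.
  rewrite linearZ /= (pihomog_ne0 _ (Whom j lejd)) ?scaler0 //.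
  by apply: contraNneq jk => e; apply/eqP/val_inj => /=; lia.
rewrite linearZ /= pihomog_dE ?Whom // => /eqP.
by rewrite scaler_eq0 invr_eq0 pnatr_eq0 eqn0Ngt fact_gt0 => /eqP.
Qed.


(** * The Chern, lambda, determinant and Todd homomorphisms *)

Section Pair.
Variables (f g : polyfun L) (hfg : Riemann_Roch_pair f g).

(** As [d_(ku)] = k [d_u], the i-th power sum is multiplied by k^i. *)
Lemma shift_ann_adams s k :
  s \in shift_ann f -> glift (fun u => shift (u *+ k)) s \in shift_ann f.
Proof.
move=> /(shift_annP _ hfg) sf; apply/(shift_annP _ hfg) => i.
rewrite glift_glift -(mulr0 (k ^ i)%:R) -(sf i) mulr_glift.
by apply: eq_glift => u; rewrite glift_shift dclsMn exprMn_n mulr_natl.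
Qed.

(** With w = [glift id s], the first power sum is [d_w] = 0, so T^w and T^0 have the same power
    sums. *)
Lemma shift_ann_det s :
  s \in shift_ann f -> shift (glift id s) - 1 \in shift_ann f.
Proof.
move=> /(shift_annP _ hfg) sf; apply/(shift_annP _ hfg) => i.
rewrite raddfB /= -shift0 !glift_shift [dcls g (glift id s)](_ : _ = dcls g 0).
  by rewrite subrr.
rewrite /dcls raddf0 raddf0 -(sf 1%N) glift_dclsX !raddf_glift.
exact: eq_glift.
Qed.

Lemma one_addX_coef_eq0 k : (1 + psX : pseries int) k.+2 = 0.
Proof. exact: addr0. Qed.

Lemma ps_subst_one_addX (R : comPzRingType) (a : R) :
  ps_subst (intr : {rmorphism int -> R}) a (1 + psX) = 1 + psC a * psX.
Proof.
apply/funext => n; rewrite -[RHS]/(_ n + _ n) ps_mul_coef /ps_subst.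
rewrite big_ord_recl big1 ?addr0 => [|i _]; last by rewrite mul0r.
by case: n => [|[|n]]; rewrite /= /psC !(mulr1, mul1r, mulr0, addr0, add0r, mulr0z, mul0r).
Qed.

Lemma exists_chern : exists c : Kring f -> Aring g,
  unit_hom c /\ (forall u : L, c (Tcls f u) = 1 + dcls g u).
Proof.
have [d gd] := hfg.1.
(* The exponent d + 1 would do for nilpotency; d + 2 guarantees that the truncated sum contains the
   terms 1 and [d_u] even when d = 0. *)
have nilp u : dcls g u ^+ d.+2 = 0 by apply: dcls_nilpotent gd _.
pose h u := usubst_at1 (intr : {rmorphism int -> Aring g}) ps_one_addX_inv (nilp u).
have [s sf|c [c_hom cE]] := @unit_hom_quot _ L (shift_ann f) h.
  apply: prod_usubst_at1_eq1 => // [|k]; first exact: Aring_torsion_free.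
  by move/(shift_annP _ hfg): sf.
exists c; split=> // u; rewrite cE glift_shift -[uval _]/(\sum_(k < d.+2) _).
rewrite big_ord_recl big_ord_recl big1 ?addr0 => [|k _].
  by rewrite /ps_subst /= mulr1 mul1r.
by rewrite /ps_subst one_addX_coef_eq0 mul0r.
Qed.

Lemma exists_lambda : exists lam : Kring f -> pseries (Kring f),
  unit_hom lam /\ (forall u : L, lam (Tcls f u) = 1 + psC (Tcls f u) * psX).
Proof.
pose h u := usubst (intr : {rmorphism int -> Kring f}) ps_one_addX_inv (Tcls f u).
have [s sf|lam [lam_hom lamE]] := @unit_hom_quot _ L (shift_ann f) h.
  apply: prod_usubst_eq1 => // [|k]; first exact: Kring_torsion_free.
  (* The power sums of the [T^u] are the classes of the Adams operations on s. *)
  have /qcls_eq0 <- := shift_ann_adams k.+1 sf.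
  rewrite raddf_glift; apply: eq_glift => u /=.
  by rewrite /Tcls -rmorphXn -shiftMn.
exists lam; split=> // u; rewrite lamE glift_shift.
exact: ps_subst_one_addX.
Qed.

(** Since u -> [T^u] is a homomorphism, the product over s collapses to one [T^w], so the values lie
    in the image of the lattice. *)
Lemma exists_det : exists det : Kring f -> Kring f,
  [/\ unit_hom det, forall x, in_K1 (det x)
    & forall u : L, det (Tcls f u) = Tcls f u].
Proof.
have TD u v : Tcls f (u + v) = Tcls f u * Tcls f v.
  by rewrite /Tcls shiftD rmorphM.
have TN u : Tcls f u * Tcls f (- u) = 1 by rewrite -TD subrr /Tcls rmorph1.
pose h u := upair (TN u).
have h_zmod : zmod_morphism h by move=> u v; apply: unit_pair_inj; apply: TD.
pose h_hb := GRing.isZmodMorphism.Build L _ h h_zmod.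
pose h_add : {additive L -> unit_pair (Kring f)} := HB.pack h h_hb.
have hE s : glift h s = h (glift id s).
  by rewrite -[RHS]/(h_add _) raddf_glift.
have [s sf|det [det_hom detE]] := @unit_hom_quot _ L (shift_ann f) h.
  rewrite hE; apply: unit_pair_inj; apply/qcls_eq.
  exact: shift_ann_det.
exists det; split=> // [x|u]; last by rewrite detE glift_shift.
by have [s ->] := qcls_surj x; exists (glift id s); rewrite detE hE.
Qed.

(** The series is [todd], with inverse (1 - exp(-x))/x, at the [d_u]; its rational coefficients
    require QA_g, to which [iota_rat] carries the vanishing power sums. *)
Lemma exists_todd : exists Td : Kring f -> QAring g,
  unit_hom Td /\ (forall u : L, ps_value todd (Qdcls g u) (Td (Tcls f u))).
Proof.
have [d gd] := hfg.1.
have nilp u : Qdcls g u ^+ d.+1 = 0.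
  by rewrite /Qdcls -rmorphXn (dcls_nilpotent _ gd) ?rmorph0.
pose h u := usubst_at1 (@rat_const (Aring g)) todd_mulE (nilp u).
have [s sf|Td [Td_hom TdE]] := @unit_hom_quot _ L (shift_ann f) h.
  apply: prod_usubst_at1_eq1 => // [||k]; first exact: rationalization_torsion_free.
    exact: todd0.
  move/(shift_annP _ hfg)/(_ k.+1): sf => /(congr1 (@iota_rat _)).
  rewrite raddf0 raddf_glift => <-; apply: eq_glift => u.
  by rewrite /Qdcls -rmorphXn.
exists Td; split=> // u; exists d.+1; split=> //.
by rewrite TdE glift_shift.
Qed.

End Pair.
End RiemannRochPair.

Theorem theorem1p2 (L : zlatticeType) (f g : polyfun L)
    (hfg : Riemann_Roch_pair f g) :
  [/\ exists c : Kring f -> Aring g,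
        unit_hom c /\ (forall u : L, c (Tcls f u) = 1 + dcls g u),
      exists lam : Kring f -> pseries (Kring f),
        unit_hom lam /\ (forall u : L, lam (Tcls f u) = 1 + psC (Tcls f u) * psX),
      exists det : Kring f -> Kring f,
        [/\ unit_hom det,
            (forall x, in_K1 (det x)) &
            (forall u : L, det (Tcls f u) = Tcls f u)] &
      exists Td : Kring f -> QAring g,
        unit_hom Td /\ (forall u : L, ps_value todd (Qdcls g u) (Td (Tcls f u)))].
Proof.
by split; [apply: exists_chern hfg|apply: exists_lambda hfg
  |apply: exists_det hfg|apply: exists_todd hfg].
Qed.
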